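(* Let $G$ be a finite group and let $A\subseteq G$ be a subgroup; write $K_{G:A}=\bigcap_{g\in G}A^g$ for the core of $A$ in $G$. (i) If $A$ is an mt-stabilizer in $G$ and $G/K_{G:A}$ is solvable, then $\pi(G:A)=\pi(G/K_{G:A})$. In particular, for a solvable minimally transitive permutation group $G$ of degree $n$ we have $\pi(G)=\pi(n)$. (ii) If $A/K_{G:A}$ is contained in the Frattini subgroup of $G/K_{G:A}$, then $A$ is an mt-stabilizer in $G$. Conversely, if $G/K_{G:A}$ is nilpotent and $A$ is an mt-stabilizer in $G$, then $A/K_{G:A}$ is contained in the Frattini subgroup of $G/K_{G:A}$. (iii) If $A$ is an mt-stabilizer in $G$ and $|G:A|=p^i$ for some prime $p$, then $G/K_{G:A}$ is a $p$-group and $A/K_{G:A}$ is contained in the Frattini subgroup of $G/K_{G:A}$.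
   Context: All groups are finite. For a subgroup $A$ of $G$, $G:A$ denotes the set of cosets of $A$ in $G$ with the natural transitive action of $G$; its kernel is the core $K_{G:A}=\bigcap_{g\in G}A^g$. The subgroup $A$ is an mt-stabilizer in $G$ (equivalently, $G$ acts minimally transitively on $G:A$) if every subgroup $H$ with $K_{G:A}\subseteq H\subsetneq G$ acts intransitively on $G:A$; that is, whenever a subgroup $H\subseteq G$ is transitive on $G:A$, then $HK_{G:A}=G$. A transitive permutation group $G$ on a finite set $\Omega$ is minimally transitive if every proper subgroup of $G$ is intransitive on $\Omega$; its degree is $|\Omega|$. For an integer $n$, $\pi(n)$ is the set of primes dividing $n$; $\pi(G)$ and $\pi(G:A)$ are the sets of primes dividing $|G|$ and $|G:A|$ respectively. *)

(* Defs.v *)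
From mathcomp Require Import all_boot all_fingroup all_solvable.

Set Implicit Arguments.
Unset Strict Implicit.
Unset Printing Implicit Defensive.

Import GroupScope.

(* The set of cosets G : A is [rcosets A G], on which G acts by right
   multiplication ['Rs]; its kernel, the core of A in G, is [gcore A G]. *)
Definition mt_stabilizer (gT : finGroupType) (G A : {group gT}) : Prop :=
  A \subset G /\
  forall H : {group gT}, gcore A G \subset H -> H \proper G ->
    ~~ [transitive H, on rcosets A G | 'Rs].

Definition minimally_transitive (T : finType) (G : {group {perm T}}) : Prop :=
  [transitive G, on [set: T] | 'P] /\
  forall H : {group {perm T}}, H \proper G ->
    ~~ [transitive H, on [set: T] | 'P].

(* Main.v *)
Require Import Defs.
From mathcomp Require Import all_boot all_fingroup all_solvable.

Set Implicit Arguments.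
Unset Strict Implicit.
Unset Printing Implicit Defensive.

Import GroupScope.

(** A subgroup [H] of [G] is transitive on the cosets of [A] exactly when
    [A * H = G], so minimal transitivity is a statement about factorizations:
    modulo the core of [A], the image [B] of [A] has no proper supplement in
    the quotient [X] (lemma [mt_stabilizer_quotientP]).  All three parts are
    read off from this form.

    If [X] has a Hall subgroup [H] for the primes dividing [#|X : B|], then
    the indices of [B] and [H] are coprime, hence [B * H = X] and so [H = X]:
    [X] involves only primes dividing [#|X : B|] (lemma [Hall_pgroup]).  Hall's
    theorem provides [H] when [X] is solvable, which gives (i), and Sylow's
    theorem provides it when [#|X : B|] is a power of [p], which gives the
    first half of (iii).  For a permutation group, the same argument applies
    with a point stabilizer as [B].

    The Frattini subgroup consists of nongenerators, so none of its subgroups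
    has a proper supplement.  Conversely, in a nilpotent group every maximal
    subgroup [M] is normal, so a subgroup [B] outside [M] would satisfy
    [B * M = X]; a subgroup without proper supplement thus lies in all maximal
    subgroups.  This gives (ii), and also the second half of (iii) since
    [p]-groups are nilpotent. *)

Definition no_proper_supplement (gT : finGroupType) (X B : {group gT}) :=
  forall H : {group gT}, H \subset X -> B * H = X -> H :=: X.

Lemma transitive_rcosetsP (gT : finGroupType) (G A H : {group gT}) :
    A \subset G -> H \subset G ->
  reflect (A * H = G) [transitive H, on rcosets A G | 'Rs].
Proof.
move=> sAG sHG.
have AinGA: (A : {set gT}) \in rcosets A G.
  by apply/rcosetsP; exists 1; rewrite ?group1 ?mulg1.
have stabA: 'C_G[(A : {set gT}) | 'Rs] = A by rewrite astab1Rs (setIidPr sAG).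
have := subgroup_transitiveP AinGA sHG (transRs_rcosets A G).
by rewrite stabA.
Qed.

(** Subgroups of [G] containing the core [K] correspond to subgroups of
    [G / K]; since [K] lies in [A], a factorization of [G / K] by [A / K]
    pulls back to one of [G] by [A]. *)
Lemma mt_stabilizer_quotientP (gT : finGroupType) (G A : {group gT}) :
    A \subset G ->
  mt_stabilizer G A <->
  no_proper_supplement (G / gcore A G)%G (A / gcore A G)%G.
Proof.
move=> sAG; have nKG := gcore_normal sAG; set K := gcore_group A G in nKG *.
have nKA: K <| A := normalS (gcore_sub A G) sAG nKG.
split=> [[_ mtA] Q sQG defG | noSupp].
  pose H := (coset K @*^-1 Q)%G.
  have sKH: K \subset H := sub_cosetpre Q.
  have defH: H / K = Q by rewrite /= cosetpreK.
  have sHG: H \subset G by rewrite -(quotientGK nKG) morphpreS.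
  have mulAH: A * H = G.
    rewrite -{1}(quotientGK nKA) -(quotientGK nKG) /= -defG.
    by rewrite morphpreMl //=; apply: morphimS (normal_norm nKA).
  move: (sHG); rewrite subEproper => /predU1P[eqHG | prHG].
    by rewrite -defH eqHG.
  by case/negP: (mtA H sKH prHG); apply/transitive_rcosetsP.
split=> // H sKH prHG; have sHG := proper_sub prHG.
apply/negP=> /(transitive_rcosetsP sAG sHG) mulAH.
have nKH: K <| H := normalS sKH sHG nKG.
have eqGH: H / K = G / K.
  apply: (noSupp (H / K)%G); first exact: quotientS sHG.
  by rewrite -(quotientMl H (normal_norm nKA)) mulAH.
by move: prHG; rewrite properE (quotient_inj nKH nKG eqGH) subxx andbF.
Qed.

(** Two subgroups of coprime indices factorize the group, so the Hall subgroup
    [H] is a supplement of [B]. *)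
Lemma Hall_pgroup (gT : finGroupType) (pi : nat_pred) (X B H : {group gT}) :
    B \subset X -> no_proper_supplement X B -> pi.-nat #|X : B| ->
  pi.-Hall(X) H -> pi.-group X.
Proof.
move=> sBX noSupp piXB /and3P[sHX piH pi'XH].
have mulBH: B * H = X := coprime_index_mulG sBX sHX (pnat_coprime piXB pi'XH).
by rewrite -(noSupp H sHX mulBH).
Qed.

Lemma solvable_no_proper_supplement_pi (gT : finGroupType) (X B : {group gT}) :
    B \subset X -> solvable X -> no_proper_supplement X B ->
  \pi(#|X|) =i \pi(#|X : B|).
Proof.
move=> sBX solX noSupp p.
apply/idP/idP; last exact: pi_of_dvd (dvdn_indexg X B) _ _.
have [H hallH] := Hall_exists \pi(#|X : B|) solX.
have piX := Hall_pgroup sBX noSupp (pnat_pi (indexg_gt0 X B)) hallH.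
exact: pnatPpi piX.
Qed.

(** If [B * H = X] then ['Phi(X)] and [H] together generate [X], and the
    nongenerators in ['Phi(X)] can be dropped. *)
Lemma sub_Phi_no_proper_supplement (gT : finGroupType) (X B : {group gT}) :
  B \subset 'Phi(X) -> no_proper_supplement X B.
Proof.
move=> sBPhi H sHX mulBH; rewrite -(genGid H); apply: Phi_nongen.
apply/eqP; rewrite eqEsubset join_subG Phi_sub sHX /= -{1}mulBH.
by rewrite mul_subG ?joing_subr // (subset_trans sBPhi) ?joing_subl.
Qed.

(** Normalizers grow in a nilpotent group, so the normalizer of a maximal
    subgroup is the whole group. *)
Lemma nilpotent_maximal_normal (gT : finGroupType) (X M : {group gT}) :
  nilpotent X -> maximal M X -> M <| X.
Proof.
move=> nilX maxM; have prMX := maxgroupp maxM.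
have /maxgroupP[_ max_M] := maxM.
have prMN := nilpotent_proper_norm nilX prMX.
rewrite /normal (proper_sub prMX) /=.
have := subsetIl X 'N(M); rewrite subEproper => /predU1P[/setIidPl // | prNX].
by have := prMN; rewrite (max_M _ prNX (proper_sub prMN)) properxx.
Qed.

(** A maximal subgroup that does not contain [B] is normal, hence would be a
    proper supplement of [B]. *)
Lemma nilpotent_no_proper_supplement_sub_Phi
    (gT : finGroupType) (X B : {group gT}) :
    B \subset X -> nilpotent X -> no_proper_supplement X B ->
  B \subset 'Phi(X).
Proof.
move=> sBX nilX noSupp; apply/bigcapsP=> M /predU1P[-> // | maxM].
have prMX := maxgroupp maxM.
have nMX := nilpotent_maximal_normal nilX maxM.
apply/idPn=> not_sBM.
have mulMB := mulg_normal_maximal nMX maxM sBX not_sBM.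
have mulBM: B * M = X by rewrite normC // (subset_trans sBX) // normal_norm.
by have := prMX; rewrite (noSupp M (proper_sub prMX) mulBM) properxx.
Qed.

(** Minimal transitivity says that a point stabilizer, of index [#|T|], has no
    proper supplement. *)
Lemma solvable_minimally_transitive_pi (T : finType) (P : {group {perm T}}) :
  solvable P -> minimally_transitive P -> \pi(#|P|) =i \pi(#|T|).
Proof.
move=> solP [trP mtP].
have /imsetP[x Tx orbP] := trP.
have cardT: #|P : 'C_P[x | 'P]| = #|T| by rewrite -card_orbit -orbP cardsT.
rewrite -cardT; apply: solvable_no_proper_supplement_pi => //.
  exact: subsetIl.
move=> H sHP mulH; move: (sHP); rewrite subEproper => /predU1P[// | prHP].
by case/negP: (mtP H prHP); apply/(subgroup_transitiveP Tx sHP trP).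
Qed.

Theorem theorem3p1 (gT : finGroupType) (G A : {group gT}) (sAG : A \subset G) :
  (* (i) *)
  ((mt_stabilizer G A -> solvable (G / gcore A G) ->
      \pi(#|G : A|) =i \pi(#|G / gcore A G|)) /\
   (forall (T : finType) (P : {group {perm T}}) (n : nat),
      #|T| = n -> solvable P -> minimally_transitive P ->
      \pi(#|P|) =i \pi(n))) /\
  (* (ii) *)
  ((A / gcore A G \subset 'Phi(G / gcore A G) -> mt_stabilizer G A) /\
   (nilpotent (G / gcore A G) -> mt_stabilizer G A ->
      A / gcore A G \subset 'Phi(G / gcore A G))) /\
  (* (iii) *)
  (forall p i : nat,
     mt_stabilizer G A -> prime p -> #|G : A| = (p ^ i)%N ->
     p.-group (G / gcore A G) /\ A / gcore A G \subset 'Phi(G / gcore A G)).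
Proof.
have mtP := mt_stabilizer_quotientP sAG.
have nKG := gcore_normal sAG; have sKA := gcore_sub A G.
have sAGq: A / gcore A G \subset G / gcore A G := quotientS _ sAG.
have indexq: #|G / gcore A G : A / gcore A G| = #|G : A|.
  by rewrite index_quotient_eq ?normal_norm // subIset // sKA orbT.
have nil_mt: nilpotent (G / gcore A G) -> mt_stabilizer G A ->
    A / gcore A G \subset 'Phi(G / gcore A G).
  by move=> nilG /mtP; apply: nilpotent_no_proper_supplement_sub_Phi.
split; [split | split; [split=> // |]].
- move=> /mtP noSupp solG p.
  by rewrite -indexq (solvable_no_proper_supplement_pi sAGq solG noSupp).
- by move=> T P n <-; apply: solvable_minimally_transitive_pi.
- by move=> sAPhi; apply/mtP; apply: sub_Phi_no_proper_supplement.
move=> p i mtA pr_p indexGA.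
have [S sylS] := Sylow_exists p (G / gcore A G).
have pG: p.-group (G / gcore A G).
  apply: (Hall_pgroup sAGq _ _ sylS); first exact/mtP.
  by rewrite /= indexq indexGA pnatX pnat_id.
by split=> //; apply: nil_mt => //; apply: pgroup_nil pG.
Qed.
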